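(* Let $G$ be a finitely generated group with infinite FC-centre. Then any unitary representation $\pi$ of $G$ with finite stabilisers satisfies $\overline{H}^1(G,\pi)=0$.
   Context: The FC-centre of $G$ is the subgroup of elements with finite conjugacy class. A unitary representation $\pi$ on a Hilbert space $\mathsf{H}$ has finite stabilisers if for every $\xi\in\mathsf{H}\setminus\{0\}$ the set $\{g\in G:\pi(g)\xi=\xi\}$ is finite. A cocycle is a map $b:G\to\mathsf{H}$ with $b(gh)=b(g)+\pi(g)b(h)$; coboundaries are the cocycles $g\mapsto\pi(g)\xi-\xi$; $\overline{H}^1(G,\pi)$ is the quotient of the space of cocycles by the closure (for pointwise convergence on $G$) of the space of coboundaries. *)

(* Defs.v *)
From HB Require Import structures.
From mathcomp Require Import all_boot all_order all_algebra.
From mathcomp Require Import all_classical all_reals all_analysis.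
From mathcomp.real_closed Require Import complex.
Import Order.TTheory GRing.Theory Num.Theory.
Import numFieldNormedType.Exports.

Set Implicit Arguments.
Unset Strict Implicit.
Unset Printing Implicit Defensive.

Local Open Scope classical_set_scope.
Local Open Scope ring_scope.

Definition subgroup_gen (G : groupType) (S : set G) : set G :=
  [set g | forall K : groupClosed G, (forall s, S s -> s \in K) -> g \in K].

Definition finitely_generated (G : groupType) : Prop :=
  exists2 S : set G, finite_set S & subgroup_gen S = setT.

Definition FC_centre (G : groupType) : set G :=
  [set g | finite_set [set (g ^ h)%g | h in [set: G]]].

Arguments FC_centre G : clear implicits.

(* A complex Hilbert space is a complete normed space over [R[i]] together
   with an inner product, linear in its first argument, inducing its norm. *)
Definition induces_norm (R : realType) (H : completeNormedModType R[i])
    (dot : {dot H for Num.conj}) : Prop :=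
  forall u : H, `|u| ^+ 2 = dot u u.

(* The operators are unitary: they preserve the inner product, and are
   bijective since [pi g] and [pi g^-1] are mutually inverse. *)
Record unitary_rep (R : realType) (G : groupType)
    (H : completeNormedModType R[i]) (dot : {dot H for Num.conj}) := UnitaryRep {
  urep :> G -> {linear H -> H} ;
  urep1 : forall u, urep 1%g u = u ;
  urepM : forall g h u, urep (g * h)%g u = urep g (urep h u) ;
  urep_dot : forall g u v, dot (urep g u) (urep g v) = dot u v }.

Definition finite_stabilisers (R : realType) (G : groupType)
    (H : completeNormedModType R[i]) (dot : {dot H for Num.conj})
    (pi : unitary_rep G dot) : Prop :=
  forall xi : H, xi != 0 -> finite_set [set g | pi g xi = xi].

Section ReducedCohomology.
Variables (R : realType) (G : groupType) (H : completeNormedModType R[i]).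
Variables (dot : {dot H for Num.conj}) (pi : unitary_rep G dot).

Definition cocycle : {pred G -> H} :=
  fun b => `[< forall g h, b (g * h)%g = b g + pi g (b h) >].

Lemma cocycleP (b : G -> H) :
  reflect (forall g h, b (g * h)%g = b g + pi g (b h)) (b \in cocycle).
Proof. exact: asboolP. Qed.

Fact cocycle_zmod_closed : zmod_closed cocycle.
Proof.
split=> [|b c /cocycleP bZ /cocycleP cZ]; apply/cocycleP => g h /=.
  by rewrite linear0 addr0.
rewrite !fctE.
by rewrite bZ cZ linearB /= opprD addrACA.
Qed.

HB.instance Definition _ :=
  GRing.isZmodClosed.Build (G -> H) cocycle cocycle_zmod_closed.

Record cocycles := Cocycles {
  cocycle_fun :> G -> H ; _ : cocycle_fun \in cocycle }.

HB.instance Definition _ := [isSub for cocycle_fun].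
HB.instance Definition _ := [Choice of cocycles by <:].
HB.instance Definition _ := [SubChoice_isSubZmodule of cocycles by <:].

(* The topology of pointwise convergence on cocycles: it is induced from the
   product topology on [G -> H]. *)
HB.instance Definition _ := Topological.copy cocycles
  (initial_topology (cocycle_fun : cocycles -> {ptws G -> H})).

Definition coboundaries : set cocycles :=
  [set b | exists xi : H, forall g, b g = pi g xi - xi].

Definition closed_coboundaries : {pred cocycles} :=
  fun b => `[< closure coboundaries b >].

Lemma cocycle_eval_continuous (g : G) :
  continuous (fun b : cocycles => (b g : H)).
Proof.
move=> b; apply: (@continuous_comp _ _ _
  (cocycle_fun : cocycles -> {ptws G -> H}) (fun f => f g)).
  exact: (@initial_continuous cocycles {ptws G -> H} cocycle_fun).
exact: (@proj_continuous G (fun=> H) g).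
Qed.

Lemma cvg_cocycles (F : set_system cocycles) (b : cocycles) : Filter F ->
  (forall g, (fun c : cocycles => (c g : H)) @ F --> (b g : H)) -> F --> b.
Proof.
move=> FF Fb; have Fptws : (cocycle_fun @ F) --> (b : {ptws G -> H}).
  apply/cvg_sup => g A [_ [[B oB <-] /= Bbg BA]].
  have /Fb : nbhs (b g : H) B by apply: open_nbhs_nbhs.
  move=> FB.
  by apply: (@filterS _ F _ _ _ _ FB) => c /= /BA.
move=> A [_ [[B oB <-] /= Bb BA]].
have /Fptws FB : nbhs (b : {ptws G -> H}) B by apply: open_nbhs_nbhs.
by apply: (@filterS _ F _ _ _ _ FB) => c /= /BA.
Qed.

Fact closed_coboundaries_zmod_closed : zmod_closed closed_coboundaries.
Proof.
split=> [|a b /asboolP clBa /asboolP clBb]; apply/asboolP.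
  apply: (@subset_closure cocycles coboundaries 0).
  by exists 0 => g; rewrite linear0 subrr.
have subc : (fun p : cocycles * cocycles => p.1 - p.2) @ (nbhs a, nbhs b)
    --> (a - b : cocycles).
  apply: cvg_cocycles => g /=.
  have := @cvgB _ H _ (filter_prod (nbhs a) (nbhs b)) _
    (fun p => p.1 g) (fun p => p.2 g) (a g) (b g); apply.
    apply: (@cvg_comp _ _ _ fst (fun c : cocycles => c g : H) _ (nbhs a)).
      exact: cvg_fst.
    exact: cocycle_eval_continuous.
  apply: (@cvg_comp _ _ _ snd (fun c : cocycles => c g : H) _ (nbhs b)).
    exact: cvg_snd.
  exact: cocycle_eval_continuous.
move=> A /subc [[P Q] [/= /clBa[c [[xi cE] Pc]] /clBb[d [[eta dE] Qd]]] PQA].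
exists (c - d); split; last exact: (PQA (c, d)).
exists (xi - eta) => g; rewrite linearB /= !fctE cE dE.
by rewrite !opprD addrACA.
Qed.

HB.instance Definition _ := GRing.isZmodClosed.Build cocycles
  closed_coboundaries closed_coboundaries_zmod_closed.

(* Only the additive group structure of the quotient space is kept. *)
Definition reduced_H1 : zmodType := Quotient.quot closed_coboundaries.

End ReducedCohomology.

(* Main.v *)
(* Let b be a cocycle and A the set of additive contractions T of H commuting
   with pi such that b - T b is a coboundary.  A is convex and closed under
   composition.  If K is a finite conjugacy class, the average P of pi over K
   is in A: summing b(k) + pi(k) b(g) = b(kg) = b(g) + pi(g) b(k^g) over k in K
   exhibits b - P b as the coboundary of minus the mean of b on K.
   For v in H, the vector of minimal norm in the closure of {T v : T in A} is
   fixed by every such P.  It is then fixed by the whole FC-centre, since an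
   average of vectors of equal norm has that norm only if they coincide;
   finiteness of stabilisers forces it to be 0.  So some T in A makes v small,
   and composing such contractions makes T b small on any given finite set,
   where b is then close to the coboundary b - T b. *)
Require Import Defs.
From mathcomp Require Import all_boot all_order all_algebra.
From mathcomp Require Import all_classical all_reals all_analysis.
From mathcomp.real_closed Require Import complex.
From mathcomp Require Import ring lra.
Import Order.TTheory GRing.Theory Num.Theory.
Import numFieldNormedType.Exports.

Set Implicit Arguments.
Unset Strict Implicit.
Unset Printing Implicit Defensive.

Local Open Scope classical_set_scope.
Local Open Scope ring_scope.

(** * Parallelogram law and vectors of minimal norm *)

(** Norms in [H] lie in the partially ordered field [R[i]]; infima and [lra] call for values in
    [R]. *)
Definition rnorm {R : realType} {H : normedModType R[i]} (x : H) : R :=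
  complex.Re `|x|.

Lemma rnormE {R : realType} {H : normedModType R[i]} (x : H) :
  `|x| = (rnorm x)%:C%C.
Proof. by rewrite /rnorm RRe_real// normr_real. Qed.

Lemma rnorm_ge0 {R : realType} {H : normedModType R[i]} (x : H) :
  0 <= rnorm x.
Proof. by rewrite -lecR -rnormE; exact: normr_ge0. Qed.

Lemma norm_parallelogram (R : realType) (H : completeNormedModType R[i])
    (dot : {dot H for Num.conj}) (x y : H) : induces_norm dot ->
  `|x + y| ^+ 2 + `|x - y| ^+ 2 = 2 * (`|x| ^+ 2 + `|y| ^+ 2).
Proof.
move=> dotE; rewrite !dotE linearDl linearBl /= !linearDr !linearNr /=.
by ring.
Qed.

(** Written with the midpoint because the minimisation below uses convexity in midpoint form. *)
Lemma rnorm_parallelogram (R : realType) (H : completeNormedModType R[i])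
    (dot : {dot H for Num.conj}) (x y : H) : induces_norm dot ->
  rnorm (x - y) ^+ 2 + 4 * rnorm (2^-1 *: (x + y)) ^+ 2 =
  2 * (rnorm x ^+ 2 + rnorm y ^+ 2).
Proof.
move=> dotE; have := norm_parallelogram x y dotE.
have -> : `|x + y| = 2 * `|2^-1 *: (x + y)|.
  by rewrite normrZ normfV normr_nat mulrA divff ?mul1r// pnatr_eq0.
rewrite !rnormE exprMn -[2]/(2%:R) -(rmorph_nat (real_complex R) 2).
rewrite -!rmorphXn -!rmorphM -!rmorphD -rmorphM => /complexI E.
by rewrite -E addrC; congr (_ + _); ring.
Qed.

(* [eta] is the point of minimal norm in the closure of [C]: it exists by the
   parallelogram law and completeness, and a contraction preserving [C] maps a
   minimising sequence to a minimising sequence. *)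
Lemma contractions_fix_min (R : realType) (H : completeNormedModType R[i])
    (dot : {dot H for Num.conj}) (C : set H) : induces_norm dot ->
  C !=set0 -> (forall x y, C x -> C y -> C (2^-1 *: (x + y))) ->
  exists2 eta : H, (forall e : R[i], 0 < e -> exists2 x, C x & `|x - eta| < e) &
    forall T : H -> H, {morph T : x y / x - y} ->
      (forall x, `|T x| <= `|x|) -> (forall x, C x -> C (T x)) -> T eta = eta.
Proof.
move=> dotE [x0 Cx0] Cmid.
pose E := [set rnorm x ^+ 2 | x in C].
have lbE : has_lbound E by exists 0 => _ [x _ <-]; rewrite sqr_ge0.
have hiE : has_inf E by split => //; exists (rnorm x0 ^+ 2), x0.
pose d := inf E.
have d_le x : C x -> d <= rnorm x ^+ 2.
  by move=> Cx; apply: ge_inf => //; exists x.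
pose U (e : R) := [set x | C x /\ rnorm x ^+ 2 < d + e].
(* The midpoint lies in [C], so its term is at least [4 * d], while the right-hand side is below
   [4 * d + 4 * e]. *)
have U_close e x y : U e x -> U e y -> rnorm (x - y) ^+ 2 < 4 * e.
  move=> [Cx xe] [Cy ye].
  have := rnorm_parallelogram x y dotE.
  by have := d_le _ (Cmid _ _ Cx Cy); lra.
have U_close' (e : R[i]) : 0 < e -> exists2 e' : R, 0 < e' &
    forall x y, U e' x -> U e' y -> `|x - y| < e.
  move=> e0; have eE : e = (complex.Re e)%:C%C by rewrite RRe_real// gtr0_real.
  have Re0 : 0 < complex.Re e by rewrite -ltcR -eE.
  exists (complex.Re e ^+ 2 / 4) => [|x y /U_close h /h{h}].
    by rewrite divr_gt0// exprn_gt0.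
  rewrite mulrC divfK ?pnatr_eq0// ltr_pXn2r ?nnegrE ?rnorm_ge0 ?(ltW Re0)//.
  by rewrite rnormE eE ltcR.
pose F := filter_from [set e : R | 0 < e] U.
have FF : ProperFilter F.
  apply: filter_from_proper => [|e e0].
    apply: filter_from_filter; first by exists 1 => /=.
    move=> e f /= e0 f0; exists (Num.min e f); first by rewrite /= lt_min e0.
    move=> x [Cx]; rewrite addr_minr lt_min => /andP[xe xf].
    by split; split.
  have [_ [x Cx <-] xe] := inf_adherent e0 hiE.
  by exists x; split.
have /cauchy_cvgP/cvg_ex[eta Feta] : cauchy F.
  apply: cauchy_exP => e e0; have [e' e'0 Ue'] := U_close' e e0.
  have [x Ux] : U e' !=set0.
    by apply: (@filter_ex _ F); exists e'.
  by exists x, e' => // y Uy; rewrite -ball_normE /=; exact: Ue'.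
have near_eta (e : R[i]) e' : 0 < e -> 0 < e' ->
    exists2 x, U e' x & `|x - eta| < e.
  move=> e0 e'0.
  have Fe' : F (U e') by exists e'.
  have Fe : F [set x | `|eta - x| < e].
    by apply: Feta; apply/nbhs_ballP; exists e => // x; rewrite -ball_normE.
  have [x [Ux xe]] := filter_ex (filterI Fe' Fe).
  by exists x => //; rewrite distrC.
exists eta => [e e0|T TB Tc TC].
  by have [x [Cx _] xe] := near_eta e 1 e0 ltr01; exists x.
apply/eqP; rewrite -subr_eq0 -normr_le0; apply/ler_addgt0Pl => e e0.
have e30 : 0 < e / 3 by rewrite divr_gt0.
have [e' e'0 Ue'] := U_close' _ e30.
have [x Ux xe] := near_eta _ _ e30 e'0.
have UTx : U e' (T x).
  case: Ux => Cx xlt; split; first exact: TC.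
  apply: le_lt_trans xlt; rewrite ler_pXn2r ?nnegrE ?rnorm_ge0//.
  by rewrite -lecR -!rnormE.
(* Each of the three terms is at most [e / 3]: [x] is close to [eta], [T] is a contraction, and [x],
   [T x] are both near-minimisers. *)
have -> : T eta - eta = - T (x - eta) + ((T x - x) + (x - eta)).
  by rewrite TB opprB !subrKA.
apply: le_trans (ler_normD _ _) _; rewrite addr0 normrN.
have -> : e = e / 3 + (e / 3 + e / 3) by field.
apply: lerD; first exact: le_trans (Tc _) (ltW xe).
by apply: le_trans (ler_normD _ _) _; rewrite lerD// ltW// Ue'.
Qed.

(** * Finite conjugacy classes and averages over them *)

Lemma FC_centre_conj_invariant_seq (G : groupType) (z : G) :
  FC_centre G z ->
  exists2 s : seq G, z \in s & forall g, perm_eq [seq (k ^ g)%g | k <- s] s.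
Proof.
rewrite /FC_centre /= => /finite_seqP[r rE].
have sE k : k \in undup r <-> exists h, (z ^ h)%g = k.
  rewrite mem_undup; have := congr1 (fun A : set G => A k) rE => /= <-.
  by split=> [[h _ <-]|[h <-]]; exists h.
exists (undup r) => [|g]; first by apply/sE; exists 1%g; rewrite conjg1.
apply: uniq_perm; rewrite ?map_inj_uniq ?undup_uniq//; first exact: conjg_inj.
move=> k; apply/mapP/idP => [[j /sE[h <-] ->]|/sE[h <-]].
  by apply/sE; exists (h * g)%g; rewrite conjgM.
exists (z ^ (h * g^-1))%g; first by apply/sE; exists (h * g^-1)%g.
by rewrite -conjgM mulgVK.
Qed.

Lemma urep_norm (R : realType) (G : groupType)
    (H : completeNormedModType R[i]) (dot : {dot H for Num.conj})
    (pi : unitary_rep G dot) (g : G) (u : H) : induces_norm dot ->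
  `|pi g u| = `|u|.
Proof.
move=> dotE; apply/eqP; rewrite -(@eqrXn2 _ 2)//.
by rewrite !dotE urep_dot.
Qed.

Definition rep_avg (R : realType) (G : groupType)
    (H : completeNormedModType R[i]) (dot : {dot H for Num.conj})
    (pi : unitary_rep G dot) (s : seq G) (v : H) : H :=
  (size s)%:R^-1 *: \sum_(k <- s) pi k v.

(** By unitarity the squared distances from [pi k v] to [v] expand into inner products. Since the
    [pi k v] sum to [size s] copies of [v], these cancel in total, so every distance is 0. *)
Lemma rep_avg_fix (R : realType) (G : groupType)
    (H : completeNormedModType R[i]) (dot : {dot H for Num.conj})
    (pi : unitary_rep G dot) (s : seq G) (v : H) (z : G) :
  induces_norm dot -> z \in s -> rep_avg pi s v = v -> pi z v = v.
Proof.
move=> dotE zs Pv.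
have s0 : (size s)%:R != 0 :> R[i] by rewrite pnatr_eq0 size_eq0; case: s zs {Pv}.
have sumE : \sum_(k <- s) pi k v = v *+ size s.
  by rewrite -{2}Pv /rep_avg -scaler_nat scalerA divff// scale1r.
have : \sum_(k <- s) `|pi k v - v| ^+ 2 = 0.
  rewrite (eq_bigr (fun k => dot v v - dot (pi k v) v - (dot v (pi k v) - dot v v)));
    last first.
    move=> k _; rewrite dotE linearBl /= !linearDr !linearNr /= urep_dot.
    by rewrite opprD opprK.
  rewrite !sumrB -!linear_sumlz -linear_sumr sumE big_const_seq count_predT.
  by rewrite iter_addr_0 linearMnl linearMnr !subrr.
move/eqP; rewrite psumr_eq0 => [/allP/(_ z zs)|k _]; last by rewrite exprn_ge0.
by rewrite /= expf_eq0 /= normr_eq0 subr_eq0 => /eqP.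
Qed.

(** * Contractions that change the cocycle by a coboundary *)

Definition cohomologous_contraction (R : realType) (G : groupType)
    (H : completeNormedModType R[i]) (dot : {dot H for Num.conj})
    (pi : unitary_rep G dot) (b : G -> H) (T : H -> H) : Prop :=
  [/\ {morph T : x y / x - y}, forall x, `|T x| <= `|x|,
      forall g x, T (pi g x) = pi g (T x) &
      exists xi, forall g, b g - T (b g) = pi g xi - xi].

Section CohomologousContractions.
Variables (R : realType) (G : groupType) (H : completeNormedModType R[i]).
Variables (dot : {dot H for Num.conj}) (pi : unitary_rep G dot) (b : G -> H).
Hypothesis dotE : induces_norm dot.
Hypothesis bM : forall g h, b (g * h)%g = b g + pi g (b h).

Let cc := cohomologous_contraction pi b.

Lemma cohomologous_contraction_id : cc id.
Proof.
by split=> //; exists 0 => g; rewrite linear0 !subrr.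
Qed.

(** Write b - TUb = (b - Tb) + T(b - Ub); as [T] commutes with [pi], it sends the coboundary of
    [eta] to that of [T eta]. *)
Lemma cohomologous_contraction_comp T U : cc T -> cc U -> cc (T \o U).
Proof.
move=> [TB Tc Tpi [xi Txi]] [UB Uc Upi [eta Ueta]]; split=> [x y|x|g x|] /=.
- by rewrite UB TB.
- exact: le_trans (Tc _) (Uc x).
- by rewrite Upi Tpi.
exists (xi + T eta) => g; rewrite -(subrKA (T (b g))) Txi -TB Ueta TB Tpi.
by rewrite linearD /= opprD addrACA.
Qed.

Lemma cohomologous_contraction_mid T U : cc T -> cc U ->
  cc (fun x => 2^-1 *: (T x + U x)).
Proof.
move=> [TB Tc Tpi [xi Txi]] [UB Uc Upi [eta Ueta]].
have half2 (x : H) : 2^-1 *: (x + x) = x.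
  by rewrite -mulr2n -[x *+ 2]scaler_nat scalerA mulVf ?scale1r// pnatr_eq0.
split=> [x y|x|g x|] /=.
- by rewrite UB TB -scalerBr opprD addrACA.
- rewrite normrZ normfV normr_nat mulrC ler_pdivrMr ?ltr0n// mulr_natr mulr2n.
  by rewrite (le_trans (ler_normD _ _))// lerD.
- by rewrite Upi Tpi -linearD -linearZ.
exists (2^-1 *: (xi + eta)) => g.
rewrite -{1}[b g]half2 -scalerBr opprD addrACA Txi Ueta.
by rewrite linearZ linearD /= -scalerBr opprD addrACA.
Qed.

Lemma cohomologous_contraction_avg (s : seq G) :
  (0 < size s)%N ->
  (forall g, perm_eq [seq (k ^ g)%g | k <- s] s) -> cc (rep_avg pi s).
Proof.
move=> s0 s_conj.
have s_neq0 : (size s)%:R != 0 :> R[i] by rewrite pnatr_eq0 -lt0n.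
have sum_conj g (f : G -> H) : \sum_(k <- s) f (k ^ g)%g = \sum_(k <- s) f k.
  by rewrite -[RHS](perm_big _ (s_conj g)) big_map.
rewrite /rep_avg; split=> [x y|x|g x|].
- rewrite -scalerBr -sumrB; congr (_ *: _).
  by apply: eq_bigr => k _; rewrite linearB.
- rewrite normrZ normfV normr_nat mulrC ler_pdivrMr ?ltr0n//.
  rewrite (le_trans (ler_norm_sum _ _ _))//.
  under eq_bigr do rewrite urep_norm//.
  by rewrite big_const_seq count_predT iter_addr_0 mulr_natr.
- rewrite linearZ /=; congr (_ *: _).
  (* After reindexing by [k ^ g], the terms agree because kg = g(k^g). *)
  rewrite (linear_sum (pi g)) -[RHS](sum_conj g (fun k => pi g (pi k x))); apply: eq_bigr => k _.
  by rewrite -!urepM -conjgC.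
exists (- (size s)%:R^-1 *: \sum_(k <- s) b k) => g.
have bE k : b g - pi k (b g) = b k - pi g (b (k ^ g)%g).
  by apply/eqP; rewrite subr_eq addrAC eq_sym subr_eq -!bM conjgC.
apply: (scalerI s_neq0); rewrite [pi g _]linearZ /= !scalerBr !scalerA.
rewrite mulrN divff// scale1r !scaleN1r opprK addrC.
rewrite (linear_sum (pi g)) -[X in _ = - X + _](sum_conj g (fun k => pi g (b k))).
rewrite [RHS]addrC -sumrB -(eq_bigr _ (fun k _ => bE k)) sumrB addrC.
by rewrite big_const_seq count_predT iter_addr_0 scaler_nat.
Qed.

Lemma cohomologous_contraction_small (v : H) (e : R[i]) :
  infinite_set (FC_centre G) -> finite_stabilisers pi ->
  0 < e -> exists2 T, cc T & `|T v| < e.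
Proof.
move=> infFC finstab e0.
have [|x y [T ccT <-] [U ccU <-]|eta eta_lim eta_fix] :=
    @contractions_fix_min _ _ dot [set T v | T in cc] dotE.
- by exists v, id => //; exact: cohomologous_contraction_id.
- exists (fun x => 2^-1 *: (T x + U x)) => //.
  exact: cohomologous_contraction_mid.
have eta0 : eta = 0.
  apply/eqP; apply: contra_notT infFC => /finstab; apply: sub_finite_set => z.
  move=> /FC_centre_conj_invariant_seq[s zs s_conj] /=.
  apply: (rep_avg_fix dotE zs).
  have ccP : cc (rep_avg pi s).
    by apply: cohomologous_contraction_avg => //; case: s zs {s_conj}.
  have [PB Pc _ _] := ccP; apply: eta_fix => // _ [T ccT <-].
  by exists (rep_avg pi s \o T) => //; exact: cohomologous_contraction_comp.
have [_ [T ccT <-]] := eta_lim e e0.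
by rewrite eta0 subr0; exists T.
Qed.

Lemma cohomologous_contraction_small_seq (r : seq G) (e : R[i]) :
  infinite_set (FC_centre G) -> finite_stabilisers pi ->
  0 < e -> exists2 T, cc T & forall g, g \in r -> `|T (b g)| < e.
Proof.
move=> infFC finstab e0; elim: r => [|g r [T ccT Tr]].
  by exists id => //; exact: cohomologous_contraction_id.
(* [U] is chosen to shrink [T (b g)]; being a contraction, it preserves the bounds already obtained
   on [r]. *)
have [U ccU Ug] := cohomologous_contraction_small (T (b g)) infFC finstab e0.
exists (U \o T); first exact: cohomologous_contraction_comp.
move=> h; rewrite inE => /predU1P[->//|hr].
by have [_ Uc _ _] := ccU; exact: le_lt_trans (Uc _) (Tr h hr).
Qed.

End CohomologousContractions.

(** * Approximation by coboundaries and vanishing of the quotient *)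

Lemma coboundary_cocycle (R : realType) (G : groupType)
    (H : completeNormedModType R[i]) (dot : {dot H for Num.conj})
    (pi : unitary_rep G dot) (xi : H) :
  (fun g => pi g xi - xi) \in cocycle pi.
Proof.
apply/cocycleP => g h; rewrite urepM linearB /=.
by rewrite [RHS]addrC subrKA.
Qed.

(** Finite lists and tolerances index a filter base of sets of coboundaries. It converges pointwise
    to [b], so every neighbourhood of [b] contains one of these sets, which is nonempty by
    [approx]. *)
Lemma closure_coboundaries (R : realType) (G : groupType)
    (H : completeNormedModType R[i]) (dot : {dot H for Num.conj})
    (pi : unitary_rep G dot) (b : cocycles pi) :
  (forall (r : seq G) (e : R[i]), 0 < e -> exists xi : H,
     forall g, g \in r -> `|b g - (pi g xi - xi)| < e) ->
  closure (coboundaries (pi := pi)) b.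
Proof.
move=> approx.
pose U (p : seq G * R[i]) : set (cocycles pi) :=
  [set c | coboundaries c /\ forall g, g \in p.1 -> `|b g - c g| < p.2].
pose F := filter_from [set p : seq G * R[i] | 0 < p.2] U.
have FF : Filter F.
  apply: filter_from_filter; first by exists ([::], 1) => /=.
  move=> [r e] [r' e'] /= e0 e'0.
  (* The order on [R[i]] is partial; the two tolerances are comparable because positive elements are
     real. *)
  have [m [m0 me me']] : exists m, [/\ 0 < m, m <= e & m <= e'].
    have [ee'|/ltW e'e] := real_leP (gtr0_real e0) (gtr0_real e'0).
      by exists e.
    by exists e'.
  exists (r ++ r', m) => // c [cc cb].
  by split; split=> // g gr; [apply: lt_le_trans me|apply: lt_le_trans me'];
    apply: cb; rewrite /= mem_cat gr ?orbT.
have Fb : F --> b.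
  apply: cvg_cocycles => g; apply/cvgrPdist_lt => e e0.
  by exists ([:: g], e) => // c [_]; apply; rewrite inE.
move=> A /Fb[[r e] /= e0 UA].
have [xi xiP] := approx r e e0.
pose c := Cocycles (coboundary_cocycle pi xi).
exists c; split; first by exists xi.
by apply: UA; split; [exists xi|exact: xiP].
Qed.

Theorem corollary4p11 (R : realType) (G : groupType)
    (H : completeNormedModType R[i]) (dot : {dot H for Num.conj})
    (pi : unitary_rep G dot) :
  induces_norm dot ->
  finitely_generated G ->
  infinite_set (FC_centre G) ->
  finite_stabilisers pi ->
  forall c : reduced_H1 pi, c = 0.
Proof.
move=> dotE _ infFC finstab.
apply: quotW => b; have : b \in closed_coboundaries (pi := pi).
  apply/asboolP/closure_coboundaries => r e e0.
  have /cocycleP bM : (b : G -> H) \in cocycle pi by case: b.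
  have [T [_ _ _ [xi xiE]] Tr] :=
    cohomologous_contraction_small_seq dotE bM r infFC finstab e0.
  (* The coboundary of [xi] is b - Tb, so the error is exactly Tb. *)
  by exists xi => g /Tr; rewrite -xiE subKr.
by rewrite -[b in b \in _]subr0 Quotient.idealrBE => /eqP ->; exact: raddf0.
Qed.
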